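(* Let $m$ and $s$ be positive integers and $a,d_1,d_2,d_3\in\mathbb{Z}/m\mathbb{Z}$. Let $D$ be the family of the six common differences $d_1,d_2,d_3,d_2-d_1,d_3-d_2,d_1-d_3$ of the arithmetic tetrahedron $\triangle=\mathrm{AS}(a,(d_1,d_2,d_3),s)$. Suppose $\triangle$ is balanced in $\mathbb{Z}/m\mathbb{Z}$. (i) If $m$ is odd, then all elements of $D$ are invertible. (ii) If $m$ is even, then all elements of $D$ are invertible except two of them, say $\delta_1$ and $\delta_2$, which are non adjacent and satisfy $\gcd(\delta_1,m)=\gcd(\delta_2,m)=2$.
   Context: $\mathrm{AS}(a,(d_1,d_2,d_3),s)$ is the multiset $\{a+i_1d_1+i_2d_2+i_3d_3: i\in\mathbb{N}^3,\ i_1+i_2+i_3\le s-1\}$ of elements of $\mathbb{Z}/m\mathbb{Z}$. A multiset is balanced if every element of $\mathbb{Z}/m\mathbb{Z}$ occurs in it with the same multiplicity. Among the six common differences, the pairs of non adjacent ones are exactly $(d_1,d_3-d_2)$, $(d_2,d_1-d_3)$ and $(d_3,d_2-d_1)$; all other pairs are adjacent. For $x\in\mathbb{Z}/m\mathbb{Z}$, $\gcd(x,m)$ denotes the gcd of $m$ and any representative of $x$. *)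

(* Defs.v *)
From HB Require Import structures.
From mathcomp Require Import all_boot all_order all_algebra.
From mathcomp Require Import finmap multiset.

Set Implicit Arguments.
Unset Strict Implicit.
Unset Printing Implicit Defensive.

Local Open Scope ring_scope.
Local Open Scope mset_scope.

(* Z/mZ for every m > 0. The type 'Z_m is not usable here, since 'Z_1 is Z/2Z;
   'I_n.+1 is canonically a zmodType for addition mod n.+1 (including n = 0),
   with multiplication Zp_mul and unit Zp1. *)
Notation "'ZZ/' m" := 'I_(m.-1.+1) (at level 8, m at level 2, format "'ZZ/' m").

Definition invertible (m : nat) (x : ZZ/m) : Prop :=
  exists y : ZZ/m, Zp_mul x y = Zp1.

(* The condition i1 + i2 + i3 <= s - 1 forces every coordinate below s, so the
   index set is a subset of 'I_s * 'I_s * 'I_s. *)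
Definition tetra_index (s : nat) : {set 'I_s * 'I_s * 'I_s} :=
  [set i : 'I_s * 'I_s * 'I_s | (i.1.1 + i.1.2 + i.2 <= s - 1)%N].

Definition AS (m : nat) (a d1 d2 d3 : ZZ/m) (s : nat) : {mset ZZ/m} :=
  seq_mset [seq a + d1 *+ i.1.1 + d2 *+ i.1.2 + d3 *+ i.2
           | i : 'I_s * 'I_s * 'I_s <- enum (tetra_index s)].

Definition balanced (m : nat) (M : {mset ZZ/m}) : Prop :=
  forall x y : ZZ/m, M x = M y.

Definition common_diff (m : nat) (d1 d2 d3 : ZZ/m) : 6.-tuple ZZ/m :=
  [tuple d1; d2; d3; d2 - d1; d3 - d2; d1 - d3].

(* Positions in common_diff: (0, 4) is (d1, d3 - d2), (1, 5) is (d2, d1 - d3)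
   and (2, 3) is (d3, d2 - d1). *)
Definition non_adjacent (j k : 'I_6) : bool :=
  let pairs := [:: (0, 4); (1, 5); (2, 3)]%N in
  ((val j, val k) \in pairs) || ((val k, val j) \in pairs).

(* Main.v *)
Require Import Defs.
From mathcomp Require Import all_boot all_order all_algebra.
From mathcomp Require Import finmap multiset.
From mathcomp Require Import all_field.
From mathcomp Require Import ring zify.

(** If w is an m-th root of unity other than 1, then balancedness says that the
complete homogeneous polynomial h_(s-1) vanishes at (1, w^d1, w^d2, w^d3); at
w = 1 it says that m divides the cardinality binom(s+2, 3).  The six common
differences are, up to sign, the differences of the four exponents
0, d1, d2, d3, so a difference divisible by q | m is a coincidence between two
of these four values when w is a primitive q-th root of unity.  For q prime,
the cardinality forces s + 2 = c mod q with c in {0, 1, 2}; after scaling the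
repeated value to 1, the divided difference formulas for h_(s-1)(1, 1, y, z)
then show that it can only vanish for y = z = -1 and c <> 1.  This is
impossible for q odd; for q = 2 it says that the exponents split two and two by
parity and that s is even; and then for q = 4 (with c = (s + 2) mod 4, again
0 or 2) it contradicts that parity splitting. *)

Import Order.TTheory GRing.Theory Num.Theory.

Local Open Scope ring_scope.

(** * Complete homogeneous symmetric polynomials *)

(** [csym l n] is h_n evaluated at the entries of [l]. Semirings are allowed so that the value at
    all ones can be read in [nat], where divisibility makes sense. *)
Fixpoint csym {R : pzSemiRingType} (l : seq R) (n : nat) : R :=
  if l is x :: l' then \sum_(k < n.+1) x ^+ k * csym l' (n - k)
  else (n == 0%N)%:R.

Lemma csym_cons (R : pzSemiRingType) (x : R) l n :
  csym (x :: l) n = \sum_(k < n.+1) x ^+ k * csym l (n - k).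
Proof. by []. Qed.

Lemma csym_cons0 (R : pzSemiRingType) (x : R) l : csym (x :: l) 0 = csym l 0.
Proof. by rewrite /= big_ord1 mul1r. Qed.

Lemma csym_consS (R : pzSemiRingType) (x : R) l n :
  csym (x :: l) n.+1 = csym l n.+1 + x * csym (x :: l) n.
Proof.
rewrite /= big_ord_recl mul1r subn0; congr (_ + _).
by rewrite big_distrr; apply: eq_bigr => i _; rewrite /= exprS mulrA.
Qed.

Lemma csym1 (R : pzSemiRingType) (x : R) n : csym [:: x] n = x ^+ n.
Proof.
elim: n => [|n IHn]; first by rewrite csym_cons0.
by rewrite csym_consS IHn add0r exprS.
Qed.

Lemma csym_ones (R : pzSemiRingType) r n :
  csym (nseq r.+1 (1 : R)) n = 'C(n + r, r)%:R.
Proof.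
have nseqS k : nseq k.+1 1 = 1 :: nseq k (1 : R) by [].
elim: r n => [|r IHr] n; first by rewrite csym1 expr1n bin0.
elim: n => [|n IHn]; first by rewrite nseqS csym_cons0 IHr !binn.
rewrite nseqS csym_consS IHr mul1r IHn.
by rewrite -natrD -addSnnS [in RHS]addnS binS addnC.
Qed.

Lemma csym_scale (R : comPzSemiRingType) (c : R) l n :
  csym [seq c * x | x <- l] n = c ^+ n * csym l n.
Proof.
elim: l n => [|x l IHl] n /=; first by case: n => [|n]; rewrite ?mul1r ?mulr0.
rewrite big_distrr; apply: eq_bigr => k _; rewrite IHl exprMn.
by rewrite mulrACA -exprD subnKC // -ltnS.
Qed.

(** The divided difference recursion of h_n, cleared of its denominator so that it also covers x =
    y. *)
Lemma csym_divdiff (R : comPzRingType) (x y : R) l n :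
  (x - y) * csym (x :: y :: l) n = csym (x :: l) n.+1 - csym (y :: l) n.+1.
Proof.
elim: n => [|n IHn]; first by rewrite !csym_consS !csym_cons0; ring.
rewrite csym_consS mulrDr mulrCA IHn !(csym_consS _ _ l n.+1).
ring.
Qed.

(** The right side of [csym_divdiff] is antisymmetric in x and y, so x - y can be cancelled. *)
Lemma csym_swap (R : idomainType) (x y : R) l n :
  csym (x :: y :: l) n = csym (y :: x :: l) n.
Proof.
have [-> //|neq_xy] := eqVneq x y.
have /mulfI : x - y != 0 by rewrite subr_eq0.
by apply; rewrite csym_divdiff -[x - y]opprB mulNr csym_divdiff opprB.
Qed.

Lemma eq_csym_cons (R : pzSemiRingType) (x : R) l1 l2 :
  csym l1 =1 csym l2 -> csym (x :: l1) =1 csym (x :: l2).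
Proof. by move=> eq12 n /=; apply: eq_bigr => k _; rewrite eq12. Qed.

Lemma csym_perm (R : idomainType) (l1 l2 : seq R) :
  perm_eq l1 l2 -> csym l1 =1 csym l2.
Proof.
have csym_mid (x : R) l l' : csym (l ++ x :: l') =1 csym (x :: l ++ l').
  elim: l => [//|y l IHl] n; rewrite !cat_cons csym_swap.
  exact: eq_csym_cons.
elim: l1 l2 => [|x l1 IHl] l2 eq12.
  by rewrite (perm_nilP (etrans (perm_sym _ _) eq12)).
have xl2 : x \in l2 by rewrite -(perm_mem eq12) mem_head.
case/splitPr: xl2 eq12 => l l' eq12 n.
rewrite csym_mid; apply: eq_csym_cons; apply: IHl.
rewrite -(perm_cons x); apply: (perm_trans eq12).
by rewrite perm_catC /= perm_cons perm_catC.
Qed.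

(** * Repeated variables on the unit circle *)

(* [n.+3] is the exponent [n + 3] of the bialternant
   h_n(x_0, .., x_3) = det(1, x_i, x_i^2, x_i^(n+3)) / det(1, x_i, x_i^2, x_i^3). *)
Lemma csym_double_one (C : numFieldType) (y : C) n c : (c <= 2)%N ->
  y != 1 -> y ^+ n.+3 = y ^+ c ->
  csym [:: 1; 1; y] n.+1 = (n.+3 - c)%:R / (1 - y) + (c == 2)%:R.
Proof.
move=> c2 y1 yN; have y1' : 1 - y != 0 by rewrite subr_eq0 eq_sym.
have E1 := csym_divdiff _ 1 y [:: 1] n.+1.
have E2 := csym_divdiff _ 1 y [::] n.+2.
rewrite !csym1 expr1n yN in E2.
have E3 : csym [:: 1; 1] n.+2 = n.+3%:R :> C.
  by rewrite (csym_ones _ 1) bin1 addn1.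
have -> : csym [:: 1; 1; y] n.+1 = csym [:: 1; y; 1] n.+1.
  apply: eq_csym_cons; exact: csym_swap.
rewrite E3 (csym_swap _ y) in E1.
(* Multiplied by (1 - y)^2, the left side is (n+3)(1 - y) - (1 - y^c). For c = 2, 1 - y^2 = (1 -
   y)(2 - (1 - y)) yields the extra summand 1. *)
apply: (mulfI y1'); apply: (mulfI y1'); rewrite E1 mulrBr E2 natrB; last by lia.
by case: c c2 {yN E2} => [|[|[|//]]] _ /=; field.
Qed.

Lemma csym_triple_one_neq0 (C : numFieldType) (z : C) n c : (c <= 2)%N ->
  `|z| = 1 -> z ^+ n.+3 = z ^+ c -> csym [:: 1; 1; 1; z] n != 0.
Proof.
move=> c2 nz zN; have [->|z1] := eqVneq z 1.
  by rewrite (csym_ones _ 3) pnatr_eq0 -lt0n bin_gt0 leq_addl.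
apply/eqP => h0; have z1' : 1 - z != 0 by rewrite subr_eq0 eq_sym.
have := csym_divdiff _ 1 z [:: 1; 1] n.
have -> : csym [:: 1; z; 1; 1] n = csym [:: 1; 1; 1; z] n.
  by apply: csym_perm; rewrite perm_cons (perm_catC [:: z] [:: 1; 1]).
have -> : csym [:: z; 1; 1] n.+1 = csym [:: 1; 1; z] n.+1.
  by apply: csym_perm; rewrite (perm_catC [:: z] [:: 1; 1]).
rewrite h0 mulr0 (csym_double_one _ _ _ c) // (csym_ones _ 2) => /esym/eqP.
rewrite subr_eq0 => /eqP E.
have E2 : n.+3%:R * n.+2%:R = 'C(n.+3, 2)%:R * 2 :> C.
  by rewrite -!natrM [in RHS]mulnC -mul_bin_diag bin1.
have E3 : (n.+3 * n.+2)%:R * (1 - z) =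
          2 * ((n.+3 - c)%:R + (c == 2)%:R * (1 - z)) :> C.
  by rewrite natrM E2 -[in 'C(_, _)]addn2 E; field.
have nzn k : k.+1%:R != 0 :> C by rewrite pnatr_eq0.
(* Such a k makes z = 1 - 2/k a real number in [0, 1), against |z| = 1. *)
suff [k k2 Ek] : exists2 k, (1 < k)%N & k%:R * (1 - z) = 2.
  have k0 : k%:R != 0 :> C by rewrite pnatr_eq0; lia.
  have Ez : z = 1 - 2 / k%:R by rewrite -Ek; field.
  move: nz; rewrite Ez ger0_norm; last first.
    by rewrite subr_ge0 ler_pdivrMr ?mul1r ?ler_nat // ltr0n; lia.
  move/eqP; rewrite -subr_eq0 addrAC subrr add0r oppr_eq0 mulf_eq0 invr_eq0.
  by rewrite (negPf k0) pnatr_eq0.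
case: c c2 {zN E} E3 => [|[|[|//]]] _ /=.
- rewrite natrM subn0 mul0r addr0 => E3.
  exists n.+2 => //; apply: (mulfI (nzn n.+2)).
  by rewrite mulrA E3 mulrC.
- rewrite natrM subn1 mul0r addr0 => E3.
  exists n.+3 => //; apply: (mulfI (nzn n.+1)).
  by rewrite mulrA [_ * n.+3%:R]mulrC E3 mulrC.
- rewrite mul1r subn2 => E3.
  exists n.+4 => //; apply: (mulfI (nzn n)).
  (* This uses (n+3)(n+2) - 2 = (n+1)(n+4). *)
  have -> : n.+1%:R * (n.+4%:R * (1 - z)) =
            (n.+3 * n.+2)%:R * (1 - z) - 2 * (1 - z) by ring.
  by rewrite E3 /=; ring.
Qed.

Lemma csym_double_root (C : numFieldType) (y z : C) n c : (c <= 2)%N ->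
  `|y| = 1 -> `|z| = 1 -> y ^+ n.+3 = y ^+ c -> z ^+ n.+3 = z ^+ c ->
  csym [:: 1; 1; y; z] n = 0 -> [/\ y = -1, z = -1 & c != 1].
Proof.
move=> c2 ny nz yN zN h0.
have [y1|y1] := eqVneq y 1.
  by case/eqP: (csym_triple_one_neq0 _ _ _ _ c2 nz zN); rewrite -[RHS]h0 y1.
have [z1|z1] := eqVneq z 1.
  case/eqP: (csym_triple_one_neq0 _ _ _ _ c2 ny yN); rewrite -[RHS]h0 z1.
  by apply/eq_csym_cons/eq_csym_cons/csym_swap.
have y1' : 1 - y != 0 by rewrite subr_eq0 eq_sym.
have z1' : 1 - z != 0 by rewrite subr_eq0 eq_sym.
have K0 : (n.+3 - c)%:R != 0 :> C by rewrite pnatr_eq0; lia.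
(* As h_n(1,1,y,z) = 0, the values h_(n+1)(1,1,y) and h_(n+1)(1,1,z) agree, and the closed form of
   [csym_double_one] is injective in y. *)
have eq_yz : y = z.
  have := csym_divdiff _ y z [:: 1; 1] n.
  have -> : csym [:: y; z; 1; 1] n = csym [:: 1; 1; y; z] n.
    by apply: csym_perm; rewrite (perm_catC [:: y; z] [:: 1; 1]).
  rewrite h0 mulr0.
  have E (x : C) : csym [:: x; 1; 1] n.+1 = csym [:: 1; 1; x] n.+1.
    by apply: csym_perm; rewrite (perm_catC [:: x] [:: 1; 1]).
  rewrite !E !(csym_double_one _ _ _ c) // => /esym/eqP.
  rewrite subr_eq0 => /eqP/addIr/(mulfI K0)/invr_inj/addrI; exact: oppr_inj.
move: h0; rewrite -{}eq_yz {z nz zN z1 z1'} => h0.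
have := csym_divdiff _ 1 y [:: 1; y] n.
have -> : csym [:: 1; y; 1; y] n = csym [:: 1; 1; y; y] n.
  exact/eq_csym_cons/csym_swap.
rewrite h0 mulr0 (csym_double_one _ _ _ c) // => /esym/eqP.
rewrite subr_eq0 => /eqP Eyy.
have := csym_divdiff _ 1 y [:: y] n.+1.
have -> : csym [:: 1; y; y] n.+1 = csym [:: y; 1; y] n.+1 by exact: csym_swap.
have -> : csym [:: y; y] n.+2 = n.+3%:R * y ^+ n.+2.
  rewrite -[in LHS](mulr1 y).
  by rewrite (csym_scale _ _ [:: 1; 1]) (csym_ones _ 1) bin1 addn1 mulrC.
rewrite -Eyy => E1.
have := csym_divdiff _ 1 y [::] n.+2; rewrite !csym1 expr1n yN => E2.
have y0 : y != 0 by rewrite -normr_eq0 ny oner_eq0.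
(* With z = y, vanishing of h_n says h_(n+1)(1,1,y) = h_(n+1)(1,y,y); here both sides are expanded.
   Up to nonzero factors this becomes (n+3)(1+y) = 0, 2(n+2) = 0 or (n+1)(1+y) = 0 for c = 0, 1,
   2. *)
have E3 : n.+3%:R * y ^+ c * (1 - y) =
  y * (1 - y ^+ c) - y * (1 - y) ^+ 2 * ((n.+3 - c)%:R / (1 - y) + (c == 2)%:R).
  rewrite -E2 -yN exprS.
  move: E1; set A := _ + _%:R; set B := csym _ _ => E1.
  have -> : y * (1 - y) ^+ 2 * A = y * (1 - y) * ((1 - y) * A) by ring.
  rewrite E1; ring.
have nzn k : k.+1%:R != 0 :> C by rewrite pnatr_eq0.
have opp1 x : 1 + x = 0 -> x = -1 :> C.
  by move/eqP; rewrite addrC addr_eq0 => /eqP.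
case: c c2 {E1 E2 Eyy yN} E3 K0 => [|[|[|//]]] _ /= E3 K0.
- have y_opp1 : y = -1.
    apply: opp1; apply: (mulfI (mulf_neq0 (nzn n.+2) y1')); rewrite mulr0.
    have -> : n.+3%:R * (1 - y) * (1 + y) =
              n.+3%:R * y ^+ 0 * (1 - y) + n.+3%:R * (1 - y) * y by ring.
    by rewrite E3 subn0; field.
  by [].
- have /eqP : y * (1 - y) * (2 * n.+2%:R) = 0.
    have -> : y * (1 - y) * (2 * n.+2%:R) =
      n.+3%:R * y ^+ 1 * (1 - y) + y * (1 - y) * n.+1%:R by ring.
    by rewrite E3 subn1 /=; field.
  by rewrite !mulf_eq0 (negPf y0) (negPf y1') !pnatr_eq0.
- have y_opp1 : y = -1.
    apply: opp1; apply: (mulfI (mulf_neq0 (mulf_neq0 (nzn n) y0) y1')).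
    have -> : n.+1%:R * y * (1 - y) * (1 + y) =
      n.+3%:R * y ^+ 2 * (1 - y) + n.+1%:R * y * (1 - y) - 2 * y ^+ 2 * (1 - y).
      by ring.
    by rewrite E3 subn2 /=; field.
  by [].
Qed.

(** * The generating function of a balanced tetrahedron *)

(** The fourth variable 1 absorbs the slack s - 1 - i1 - i2 - i3, turning the bound on the degree
    into an equality. *)
Lemma sum_tetra_index (R : comPzSemiRingType) (x y z : R) s : (0 < s)%N ->
  \sum_(i in tetra_index s) x ^+ i.1.1 * y ^+ i.1.2 * z ^+ i.2 =
  csym [:: x; y; z; 1] (s - 1).
Proof.
case: s => [//|n] _; rewrite subn1 succnK.
transitivity (\sum_(i < n.+1) \sum_(j < n.+1 | (j < (n - i).+1)%N)
    \sum_(k < n.+1 | (k < (n - i - j).+1)%N) x ^+ i * y ^+ j * z ^+ k).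
  rewrite pair_big_dep pair_big_dep /=; apply: eq_bigl => -[[i j] k] /=.
  by rewrite inE /=; case: i j k => i Hi [j Hj] [k Hk] /=; lia.
rewrite csym_cons; apply: eq_bigr => i _; rewrite csym_cons big_distrr.
have lei : ((n - i).+1 <= n.+1)%N by lia.
rewrite (big_ord_widen _ (fun j : nat =>
  x ^+ i * (y ^+ j * csym [:: z; 1] (n - i - j))) lei).
apply: eq_bigr => j _.
have lej : ((n - i - j).+1 <= n.+1)%N by lia.
rewrite -(big_ord_widen _ (fun k : nat => x ^+ i * y ^+ j * z ^+ k) lej).
rewrite csym_cons mulrA big_distrr; apply: eq_bigr => k _.
by rewrite csym1 expr1n mulr1.
Qed.

Lemma exprZpD (R : comPzSemiRingType) n (w : R) (x y : 'I_n.+1) :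
  w ^+ n.+1 = 1 -> w ^+ (x + y)%R = w ^+ x * w ^+ y.
Proof. by move=> w1; rewrite /= expr_mod // exprD. Qed.

Lemma exprZpMn (R : comPzSemiRingType) n (w : R) (x : 'I_n.+1) k :
  w ^+ n.+1 = 1 -> w ^+ (x *+ k)%R = (w ^+ x) ^+ k.
Proof.
by move=> w1; elim: k => [//|k IHk]; rewrite mulrS exprZpD // IHk exprS.
Qed.

Lemma sum_seq_count (T : finType) (V : nmodType) (F : T -> V) (l : seq T) :
  \sum_(u <- l) F u = \sum_x F x *+ count_mem x l.
Proof.
rewrite (partition_big id xpredT) //=; apply: eq_bigr => x _.
rewrite (eq_bigr (fun=> F x)) => [|u /eqP -> //].
by rewrite big_const_seq iter_addr_0.
Qed.

(** The sum of w^u over the tetrahedron is computed by indices and by values; k is the common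
    multiplicity. The semiring is left free, to allow both w = 1 in [nat] and complex roots of
    unity. *)
Lemma balanced_generating_function (m s : nat) (a d1 d2 d3 : ZZ/m) :
  (0 < m)%N -> (0 < s)%N -> balanced (AS a d1 d2 d3 s) ->
  exists k : nat, forall (R : comPzSemiRingType) (w : R), w ^+ m = 1 ->
    w ^+ a * csym [:: w ^+ d1; w ^+ d2; w ^+ d3; 1] (s - 1) =
    (\sum_(j < m) w ^+ j) *+ k.
Proof.
case: m a d1 d2 d3 => [//|m] a d1 d2 d3 _ s0 bal.
exists (AS a d1 d2 d3 s ord0) => R w w1.
rewrite -sum_tetra_index // big_distrr -sumrMnl /=.
under [RHS]eq_bigr => j _ do rewrite (bal ord0 j) /AS mset_seqE.
rewrite -(sum_seq_count _ _ (fun j : 'I_m.+1 => w ^+ j)) big_map big_enum.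
by apply: eq_bigr => i _; rewrite !exprZpD // !exprZpMn // !mulrA.
Qed.

Lemma balanced_size_mod (m s : nat) (a d1 d2 d3 : ZZ/m) p :
  (0 < m)%N -> (0 < s)%N -> balanced (AS a d1 d2 d3 s) ->
  prime p -> (p %| m)%N -> exists2 c, (c <= 2)%N & s.+2 = c %[mod p].
Proof.
move=> m0 s0 bal p_pr pm.
have [k /(_ nat 1%N)] := balanced_generating_function m s a d1 d2 d3 m0 s0 bal.
rewrite !expr1n mul1r => /(_ erefl).
rewrite (csym_ones _ 3) natn (eq_bigr (fun=> 1)) => [|j _]; last exact: expr1n.
rewrite sumr_const card_ord natn -mulr_natr natn => E.
(* Passing from the binomial to (s+2)(s+1)s only multiplies by 3!, so p = 2 and p = 3 need no
   separate treatment. *)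
have : (p %| s.+2 ^_ 3)%N.
  rewrite -bin_ffact dvdn_mulr //.
  have -> : 'C(s.+2, 3) = (m * k)%N.
    by rewrite -[RHS]E; congr 'C(_, _); lia.
  exact: dvdn_mulr.
rewrite !ffactnS ffactn0 muln1 !Euclid_dvdM //.
case/or3P => pd; [exists 0%N | exists 1%N | exists 2%N] => //; apply/eqP.
- by rewrite mod0n.
- by rewrite eqn_mod_dvd // subn1.
- by rewrite eqn_mod_dvd // subn2.
Qed.

(** The sum of all w^j is 0, so h_(s-1) vanishes at the four powers of w; dividing them by w^x turns
    the repeated value into 1, and [csym_double_root] applies. The congruence for s + 2 is a
    hypothesis because q = 4 is also needed. *)
Lemma balanced_collision (m s : nat) (a d1 d2 d3 : ZZ/m) q (w : algC) c :
  (0 < m)%N -> (0 < s)%N -> balanced (AS a d1 d2 d3 s) ->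
  (1 < q)%N -> (q %| m)%N -> q.-primitive_root w ->
  (c <= 2)%N -> s.+2 = c %[mod q] ->
  forall x y z t, perm_eq [:: x; y; z; t] [:: d1; d2; d3; ord0] ->
    w ^+ x = w ^+ y -> [/\ w ^+ z = - w ^+ x, w ^+ t = - w ^+ x & c != 1%N].
Proof.
move=> m0 s0 bal q1 qm wq c2 sc x y z t perm_xyzt wxy.
have wm : w ^+ m = 1 by apply/eqP; rewrite -(prim_order_dvd wq).
have w_neq1 : w - 1 != 0.
  by rewrite subr_eq0 -[w]expr1 -(prim_order_dvd wq) dvdn1; lia.
have nw : `|w| = 1.
  apply/eqP; rewrite -(pexpr_eq1 (prim_order_gt0 wq) (normr_ge0 w)).
  by rewrite -normrX (prim_expr_order wq) normr1.
have w0 k : w ^+ k != 0 by rewrite expf_neq0 // -normr_eq0 nw oner_eq0.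
have [k /(_ _ w wm)] := balanced_generating_function m s a d1 d2 d3 m0 s0 bal.
have -> : \sum_(j < m) w ^+ j = 0.
  by apply: (mulfI w_neq1); rewrite mulr0 -subrX1 wm subrr.
rewrite mul0rn => /eqP; rewrite mulf_eq0 (negPf (w0 _)) orFb.
have -> : csym [:: w ^+ d1; w ^+ d2; w ^+ d3; 1] (s - 1) =
          csym [:: w ^+ x; w ^+ y; w ^+ z; w ^+ t] (s - 1).
  apply: csym_perm; rewrite perm_sym.
  exact: (perm_map (fun u : ZZ/m => w ^+ u) perm_xyzt).
have Ew u : w ^+ u = w ^+ x * (w ^+ u / w ^+ x) by rewrite mulrC divfK.
have -> : [:: w ^+ x; w ^+ y; w ^+ z; w ^+ t] =
  [seq w ^+ x * u | u <- [:: 1; 1; w ^+ z / w ^+ x; w ^+ t / w ^+ x]].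
  by rewrite /= mulr1 -wxy -!Ew.
rewrite csym_scale mulf_eq0 expf_eq0 (negPf (w0 _)) andbF orFb => /eqP.
have nu u : `|w ^+ u / w ^+ x| = 1 by rewrite normf_div !normrX nw !expr1n divr1.
have uq u : (w ^+ u / w ^+ x) ^+ q = 1.
  by rewrite expr_div_n -!exprM !(mulnC _ q) !exprM (prim_expr_order wq) !expr1n divr1.
(* With n = s - 1, the exponent n + 3 is s + 2. *)
have eu u : (w ^+ u / w ^+ x) ^+ (s - 1).+3 = (w ^+ u / w ^+ x) ^+ c.
  by rewrite -(expr_mod (s - 1).+3 (uq u)) subn1 (prednK s0) sc expr_mod.
case/(csym_double_root _ _ _ _ _ c2 (nu z) (nu t) (eu z) (eu t)) => Ez Et cN1.
by split=> //; [rewrite Ew Ez mulrN1 | rewrite Ew Et mulrN1].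
Qed.

(** * Divisibility of the common differences *)

Lemma prim_root_expr_eq (R : fieldType) (m q : nat) (w : R) (x y : ZZ/m) :
  (0 < m)%N -> (q %| m)%N -> q.-primitive_root w ->
  (w ^+ x == w ^+ y) = (q %| (x - y)%R)%N.
Proof.
case: m x y => [//|m] x y _ qm wq.
have wm : w ^+ m.+1 = 1 by apply/eqP; rewrite -(prim_order_dvd wq).
have w0 : w != 0.
  apply: contra_eq_neq wm => ->.
  by rewrite expr0n eq_sym oner_eq0.
rewrite (prim_order_dvd wq) -{1}(subrK y x) exprZpD // -{2}[w ^+ y]mul1r.
by rewrite (inj_eq (mulIf (expf_neq0 _ w0))).
Qed.

Lemma balanced_odd_prime_ndvd (m s : nat) (a d1 d2 d3 : ZZ/m) p x y z t :
  (0 < m)%N -> (0 < s)%N -> balanced (AS a d1 d2 d3 s) ->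
  perm_eq [:: x; y; z; t] [:: d1; d2; d3; ord0] ->
  prime p -> odd p -> (p %| m)%N -> ~~ (p %| (x - y)%R)%N.
Proof.
move=> m0 s0 bal xyzt p_pr p_odd pm.
have [w wp] := C_prim_root_exists (prime_gt0 p_pr).
rewrite -(prim_root_expr_eq _ _ _ w) //; apply/negP => /eqP wxy.
have [c c2 sc] := balanced_size_mod _ _ _ _ _ _ _ m0 s0 bal p_pr pm.
have [wz _ _] := balanced_collision _ _ _ _ _ _ _ w c m0 s0 bal
  (prime_gt1 p_pr) pm wp c2 sc _ _ _ _ xyzt wxy.
have wXp k : (w ^+ k) ^+ p = 1.
  by rewrite -exprM mulnC exprM (prim_expr_order wp) expr1n.
(* Raise w^z = - w^x to the odd power p. *)
have /eqP : 1 = -1 :> algC.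
  by rewrite -[LHS](wXp z) wz exprNn wXp -signr_odd p_odd expr1 mulr1.
by rewrite -subr_eq0 opprK -mulr2n pnatr_eq0.
Qed.

(** This is [balanced_collision] for q = 2 and w = -1; c is then 0 or 2, which makes s even. *)
Lemma balanced_even_parity (m s : nat) (a d1 d2 d3 : ZZ/m) x y z t :
  (0 < m)%N -> (0 < s)%N -> balanced (AS a d1 d2 d3 s) ->
  ~~ odd m ->
  perm_eq [:: x; y; z; t] [:: d1; d2; d3; ord0] ->
  odd x = odd y -> [/\ odd z = ~~ odd x, odd t = ~~ odd x & ~~ odd s].
Proof.
move=> m0 s0 bal m_even xyzt Exy.
have [m2 p2] : (2 %| m)%N /\ prime 2 by rewrite dvdn2.
have [c c2 sc] := balanced_size_mod _ _ _ _ _ _ _ m0 s0 bal p2 m2.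
have w2 : 2.-primitive_root (-1 : algC).
  apply/andP; split=> //; apply/forallP => -[[|[|//]] i2] /=; apply/eqP.
    by rewrite unity_rootE expr1 eq_sym -subr_eq0 opprK -mulr2n pnatr_eq0.
  by rewrite unity_rootE sqrrN expr1n !eqxx.
have wxy : (-1) ^+ x = (-1) ^+ y :> algC by rewrite -signr_odd Exy signr_odd.
have [wz wt c1] := balanced_collision _ _ _ _ _ _ 2 _ c m0 s0 bal
  isT m2 w2 c2 sc _ _ _ _ xyzt wxy.
have sgn_opp (u v : nat) :
    (-1) ^+ u = - (-1) ^+ v :> algC -> odd u = ~~ odd v.
  rewrite -[(-1) ^+ u]signr_odd -[(-1) ^+ v]signr_odd -signrN => /signr_inj //.
split; [exact: sgn_opp | exact: sgn_opp |].
by case: c c1 c2 sc => [|[|[|//]]] // _ _; rewrite !modn2 /=; lia.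
Qed.

Lemma balanced_four_ndvd (m s : nat) (a d1 d2 d3 : ZZ/m) x y z t :
  (0 < m)%N -> (0 < s)%N -> balanced (AS a d1 d2 d3 s) ->
  perm_eq [:: x; y; z; t] [:: d1; d2; d3; ord0] ->
  (4 %| m)%N -> ~~ (4 %| (x - y)%R)%N.
Proof.
move=> m0 s0 bal xyzt m4.
have m_even : ~~ odd m by rewrite -dvdn2; apply: dvdn_trans m4.
have [w w4] := C_prim_root_exists (isT : 0 < 4)%N.
have w2 : 2.-primitive_root (w ^+ 2).
  exact: (dvdn_prim_root w4 (isT : 2 %| 4)%N).
have par u v : (w ^+ u) ^+ 2 = (w ^+ v) ^+ 2 -> odd u = odd v.
  rewrite -!exprM !(mulnC _ 2) !exprM => /eqP.
  by rewrite (eq_prim_root_expr w2) !modn2; case: odd; case: odd.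
rewrite -(prim_root_expr_eq _ _ _ w) //; apply/negP => /eqP wxy.
have [oz ot s_even] := balanced_even_parity _ _ _ _ _ _ _ _ _ _
  m0 s0 bal m_even xyzt (par x y (congr1 (fun v => v ^+ 2) wxy)).
(* Since s is even, the residue is 0 or 2. *)
have c2 : (s.+2 %% 4 <= 2)%N by lia.
have sc : s.+2 = s.+2 %% 4 %[mod 4] by rewrite modn_mod.
have [wz _ _] := balanced_collision _ _ _ _ _ _ 4 w _ m0 s0 bal
  isT m4 w4 c2 sc _ _ _ _ xyzt wxy.
(* From w^z = - w^x the squares agree, so z and x have the same parity, contrary to [oz]. *)
have := par z x; rewrite wz sqrrN => /(_ erefl); rewrite oz.
by case: odd.
Qed.

(** * Units modulo m and the gcd with m *)

Lemma invertible_coprime (m : nat) (x : ZZ/m) :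
  (0 < m)%N -> coprime m x -> invertible x.
Proof.
case: m x => [//|m] x _ co_mx; exists (Zp_inv x).
by rewrite Zp_mulC Zp_mulVz.
Qed.

Lemma invertible_odd (m : nat) (x : ZZ/m) :
  (0 < m)%N -> ~~ odd m -> invertible x -> odd x.
Proof.
case: m x => [//|m] x _ /negPf m_even [y /(congr1 (odd \o val))] /=.
by rewrite !odd_mod // oddM; case: odd.
Qed.

Lemma coprime_prime_ndvd (m n : nat) : (0 < m)%N ->
  (forall p, prime p -> (p %| m)%N -> ~~ (p %| n)%N) -> coprime m n.
Proof.
move=> m0 ndvd; apply/negPn/negP; rewrite /coprime => g1.
have p_pr : prime (pdiv (gcdn m n)).
  by apply: pdiv_prime; have := gcdn_gt0 m n; rewrite m0; lia.
have := ndvd _ p_pr (dvdn_trans (pdiv_dvd _) (dvdn_gcdl _ _)).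
by rewrite (dvdn_trans (pdiv_dvd _) (dvdn_gcdr _ _)).
Qed.

(** The halves of m and n are coprime: a common factor 2 of the halves would make 4 divide both m
    and n. *)
Lemma gcdn_eq2 (m n : nat) : (0 < m)%N -> ~~ odd m -> ~~ odd n ->
  (forall p, prime p -> odd p -> (p %| m)%N -> ~~ (p %| n)%N) ->
  ((4 %| m)%N -> ~~ (4 %| n)%N) -> gcdn n m = 2.
Proof.
move=> m0; rewrite -!dvdn2 => /dvdnP[m' Em] /dvdnP[n' En] ndvd ndvd4.
rewrite Em En -muln_gcdl gcdnC; apply/eqP.
rewrite -[X in _ == X]mul1n eqn_pmul2r //; apply: coprime_prime_ndvd; first by lia.
move=> p p_pr pm'; have [p2|p_odd] := even_prime p_pr.
  apply: contraL (ndvd4 _) => [pn'|].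
    by rewrite En negbK -[4%N]/(2 * 2)%N dvdn_mul // -p2.
  by rewrite Em -[4%N]/(2 * 2)%N dvdn_mul // -p2.
have := ndvd p p_pr p_odd; rewrite Em dvdn_mulr // => /(_ isT).
by apply: contra => pn'; rewrite En dvdn_mulr.
Qed.

Lemma odd_subZp (m : nat) (x y : ZZ/m) : (0 < m)%N -> ~~ odd m ->
  odd (x - y)%R = odd x (+) odd y.
Proof.
case: m x y => [//|m] x y _ /negPf m_even.
by rewrite -{2}(subrK y x) /= [in RHS]odd_mod // oddD addbK.
Qed.

Close Scope ring_scope.

Theorem theorem3p8 (m s : nat) (hm : 0 < m) (hs : 0 < s)
    (a d1 d2 d3 : ZZ/m) (hbal : balanced (AS a d1 d2 d3 s)) :
  let D := common_diff d1 d2 d3 in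
  (odd m -> forall l : 'I_6, invertible (tnth D l)) /\
  (~~ odd m ->
     exists j k : 'I_6,
       [/\ non_adjacent j k,
           forall l : 'I_6, invertible (tnth D l) <-> (l <> j /\ l <> k),
           gcdn (tnth D j) m = 2 &
           gcdn (tnth D k) m = 2]).
Proof.
move=> D.
(* Each common difference is an edge x - y of the exponent set {d1, d2, d3, 0}; z and t span the
   opposite edge. *)
have D_diff l : exists x y z t,
    perm_eq [:: x; y; z; t] [:: d1; d2; d3; ord0] /\ tnth D l = (x - y)%R.
  rewrite (tnth_nth ord0); case: l => -[|[|[|[|[|[|//]]]]]] _ /=;
    [exists d1, ord0, d2, d3 | exists d2, ord0, d1, d3 | exists d3, ord0, d1, d2
    |exists d2, d1, d3, ord0 | exists d3, d2, d1, ord0 | exists d1, d3, d2, ord0];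
    split; rewrite ?(GRing.subr0) //; apply/permP => P /=; lia.
have D_ndvd l p : prime p -> odd p -> p %| m -> ~~ (p %| tnth D l).
  have [x [y [z [t [xyzt ->]]]]] := D_diff l.
  exact: (balanced_odd_prime_ndvd _ _ _ _ _ _ _ _ _ _ _ hm hs hbal xyzt).
have D_ndvd4 l : 4 %| m -> ~~ (4 %| tnth D l).
  have [x [y [z [t [xyzt ->]]]]] := D_diff l.
  exact: (balanced_four_ndvd _ _ _ _ _ _ _ _ _ _ hm hs hbal xyzt).
split=> [m_odd l|m_even].
  apply: invertible_coprime => //; apply: coprime_prime_ndvd => // p p_pr pm.
  by apply: D_ndvd => //; apply: dvdn_odd pm m_odd.
have D_inv l : invertible (tnth D l) <-> odd (tnth D l).
  split=> [|D_odd]; first exact: invertible_odd.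
  apply: invertible_coprime => //; apply: coprime_prime_ndvd => // p p_pr pm.
  have [->|p_odd] := even_prime p_pr; first by rewrite dvdn2 negbK.
  exact: D_ndvd.
have D_gcd l : ~~ odd (tnth D l) -> gcdn (tnth D l) m = 2.
  by move=> D_even; apply: gcdn_eq2 => // [p|]; [exact: D_ndvd | exact: D_ndvd4].
suff [j [k [jk D_odd]]] : exists j k : 'I_6, non_adjacent j k /\
    forall l, odd (tnth D l) = (l != j) && (l != k).
  exists j, k; split=> //.
  - move=> l; rewrite D_inv D_odd; split; first by case/andP => /eqP ? /eqP.
    by case=> /eqP -> /eqP.
  - by apply: D_gcd; rewrite D_odd eqxx.
  - by apply: D_gcd; rewrite D_odd eqxx andbF.
pose o := [:: odd d1; odd d2; odd d3; odd d2 (+) odd d1; odd d3 (+) odd d2;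
           odd d1 (+) odd d3].
have D_o l : odd (tnth D l) = nth false o l.
  rewrite (tnth_nth ord0); case: l => -[|[|[|[|[|[|//]]]]]] _ //=;
  exact: odd_subZp.
(* Among d1, d2, d3 two agree in parity, so the four exponents split two and two. As 0 is even,
   exactly one d_i is even; the even differences are d_i and the difference of the other two, a non
   adjacent pair. *)
have par x y z t := balanced_even_parity _ _ _ _ _ _ x y z t hm hs hbal m_even.
have := par d1 d2 d3 ord0 (perm_refl _).
have /(par d1 d3 d2 ord0) : perm_eq [:: d1; d3; d2; ord0] [:: d1; d2; d3; ord0].
  by apply/permP => P /=; lia.
have /(par d2 d3 d1 ord0) : perm_eq [:: d2; d3; d1; ord0] [:: d1; d2; d3; ord0].
  by apply/permP => P /=; lia.
rewrite {par} /o in D_o *.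
case: (odd d1) D_o; case: (odd d2); case: (odd d3) => D_o /=;
  do ?[by move=> /(_ erefl)[] | by move=> _ /(_ erefl)[]
      | by move=> _ _ /(_ erefl)[]] => _ _ _;
  [ exists (@Ordinal 6 2 isT), (@Ordinal 6 3 isT)
  | exists (@Ordinal 6 1 isT), (@Ordinal 6 5 isT)
  | exists (@Ordinal 6 0 isT), (@Ordinal 6 4 isT)];
  by split=> // l; rewrite D_o; case: l => -[|[|[|[|[|[|//]]]]]].
Qed.
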